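(* A ring $R$ satisfies the generating hypothesis if and only if $R$ has weak global dimension at most $1$ and all finitely presented right $R$-modules are FP-injective.
   Context: Rings are associative with unit; all modules are right modules unless stated otherwise. $\mathcal{D}(R)$ is the unbounded derived category of right $R$-modules. A perfect complex is a bounded chain complex of finitely generated projective right $R$-modules. $R$ satisfies the generating hypothesis if whenever $f\colon X\to Y$ is a map in $\mathcal{D}(R)$ between perfect complexes with $H_*f=0$, then $f=0$ in $\mathcal{D}(R)$ (for perfect complexes, $f=0$ in $\mathcal{D}(R)$ means $f$ is chain homotopic to $0$). Weak global dimension at most $1$ is equivalent to: submodules of flat modules are flat. A right module $M$ is FP-injective if $\operatorname{Ext}^1_R(F,M)=0$ for all finitely presented right $R$-modules $F$. *)

(* Defs.v *)
From HB Require Import structures.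
From mathcomp Require Import all_boot all_order all_algebra.
From mathcomp Require Import generic_quotient ring_quotient boolp.
From mathcomp.multinomials Require Import freeg.

Set Implicit Arguments.
Unset Strict Implicit.
Unset Printing Implicit Defensive.

Import GRing.Theory.
Local Open Scope ring_scope.
Local Open Scope quotient_scope.

(* Module theory is written for left modules over an arbitrary ring S.
   A right R-module is a left module over the converse ring R^c, the scalar
   [(r : R^c) *: m] being m r; right-module notions are obtained by taking
   S := R^c.  The zero ring is allowed (pzRingType). *)
Notation rmodType R := (lmodType R^c).

Section Modules.
Variable S : pzRingType.

Definition trivial_module (M : lmodType S) : Prop := forall x : M, x = 0.

Definition surjective_map (A B : Type) (f : A -> B) : Prop :=
  forall y, exists x, f x = y.

(* Exactness at B of A -> B -> C. *)
Definition exact_at (A B C : lmodType S)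
    (f : {linear A -> B}) (g : {linear B -> C}) : Prop :=
  forall y : B, g y = 0 <-> exists x : A, f x = y.

Definition projective (P : lmodType S) : Prop :=
  forall (A B : lmodType S) (p : {linear A -> B}) (g : {linear P -> B}),
    surjective_map p -> exists h : {linear P -> A}, forall x, p (h x) = g x.

Definition finitely_generated (M : lmodType S) : Prop :=
  exists (n : nat) (p : {linear 'rV[S]_n -> M}), surjective_map p.

Definition finitely_presented (M : lmodType S) : Prop :=
  exists (m n : nat) (u : {linear 'rV[S]_m -> 'rV[S]_n})
         (p : {linear 'rV[S]_n -> M}),
    exact_at u p /\ surjective_map p.

(* ... -> P 2 -> P 1 -> P 0 -> M -> 0, exact, with every P n in class C. *)
Record resolution (C : lmodType S -> Prop) (M : lmodType S) := Resolution {
  res_obj :> nat -> lmodType S;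
  res_class : forall n, C (res_obj n);
  res_d : forall n, {linear res_obj n.+1 -> res_obj n};
  res_aug : {linear res_obj 0%N -> M};
  res_aug_surj : surjective_map res_aug;
  res_exact0 : exact_at (res_d 0%N) res_aug;
  res_exactS : forall n, exact_at (res_d n.+1) (res_d n)
}.

(* Ext^{n+1}_S(F, M) = 0: for a projective resolution P of F, the cohomology of
   Hom(P 0, M) -> Hom(P 1, M) -> ... vanishes in degree n+1.  Up to isomorphism
   the cohomology does not depend on the choice of P. *)
Definition ExtS_vanishes (n : nat) (F M : lmodType S) : Prop :=
  forall (P : resolution projective F) (f : {linear P n.+1 -> M}),
    (forall x, f (res_d P n.+1 x) = 0) ->
    exists g : {linear P n -> M}, forall x, f x = g (res_d P n x).

Definition FP_injective (M : lmodType S) : Prop :=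
  forall F : lmodType S, finitely_presented F -> ExtS_vanishes 0 F M.

End Modules.

(* M (x)_R N is the free abelian group on M * N modulo the subgroup generated by
   the biadditivity and balancing relations. *)
Section Tensor.
Variables (R : pzRingType) (M : rmodType R) (N : lmodType R).

Inductive tensor_rel : {freeg (M * N)%type} -> Prop :=
| TensorRel0 : tensor_rel 0
| TensorRelB x y : tensor_rel x -> tensor_rel y -> tensor_rel (x - y)
| TensorRelDl m m' n :
    tensor_rel (<< (m + m', n) >> - << (m, n) >> - << (m', n) >>)
| TensorRelDr m n n' :
    tensor_rel (<< (m, n + n') >> - << (m, n) >> - << (m, n') >>)
| TensorRelZ m (r : R) n :
    tensor_rel (<< ((r : R^c) *: m, n) >> - << (m, r *: n) >>).

Definition tensor_relb (x : {freeg (M * N)%type}) : bool := `[< tensor_rel x >].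

Lemma tensor_relb_closed : zmod_closed tensor_relb.
Proof.
split=> [|x y /asboolP hx /asboolP hy]; apply/asboolP.
  exact: TensorRel0.
exact: TensorRelB.
Qed.

HB.instance Definition _ :=
  GRing.isZmodClosed.Build {freeg (M * N)%type} tensor_relb tensor_relb_closed.

Definition tensor_ker : zmodClosed {freeg (M * N)%type} :=
  GRing.ZmodClosed.clone _ tensor_relb _.

Definition tensor : zmodType := Quotient.quot tensor_ker.

Definition tensor_pi (x : {freeg (M * N)%type}) : tensor :=
  \pi_(Quotient.quot tensor_ker) x.

Definition tmul (m : M) (n : N) : tensor := tensor_pi << (m, n) >>.

Lemma tensor_piP x y : tensor_pi x = tensor_pi y <-> tensor_rel (x - y).
Proof.
rewrite /tensor_pi; split=> [/eqP|h].
  by rewrite -Quotient.idealrBE => /asboolP.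
by apply/eqP; rewrite -Quotient.idealrBE; apply/asboolP.
Qed.

End Tensor.

Section TensorMap.
Variables (R : pzRingType) (M : rmodType R) (N N' : lmodType R).
Variable i : {linear N -> N'}.

Definition free_map (x : {freeg (M * N)%type}) : {freeg (M * N')%type} :=
  fglift (fun p : M * N => << (p.1, i p.2) >>) x.

(* M (x) i : M (x)_R N -> M (x)_R N', computed on representatives. *)
Definition tensor_map (x : tensor M N) : tensor M N' :=
  tensor_pi (free_map (repr x)).

Lemma free_mapU m n : free_map << (m, n) >> = << (m, i n) >>.
Proof. by rewrite /free_map liftU scale1r. Qed.

Lemma free_mapB x y : free_map (x - y) = free_map x - free_map y.
Proof. exact: lift_is_additive. Qed.

Lemma free_map_rel x : tensor_rel x -> tensor_rel (free_map x).
Proof.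
elim=> [|y z _ hy _ hz|m m' n|m n n'|m r n]; rewrite ?free_mapB ?free_mapU.
- by rewrite -(subrr 0) free_mapB subrr; exact: TensorRel0.
- exact: TensorRelB.
- exact: TensorRelDl.
- by rewrite linearD; exact: TensorRelDr.
- by rewrite linearZ; exact: TensorRelZ.
Qed.

Lemma tensor_map_pi x : tensor_map (tensor_pi x) = tensor_pi (free_map x).
Proof.
apply/tensor_piP; rewrite -free_mapB; apply: free_map_rel.
by apply/tensor_piP; rewrite /tensor_pi reprK.
Qed.

Lemma tensor_map_tmul m n : tensor_map (tmul m n) = tmul m (i n).
Proof. by rewrite /tmul tensor_map_pi free_mapU. Qed.

End TensorMap.

Definition flat (R : pzRingType) (M : rmodType R) : Prop :=
  forall (N N' : lmodType R) (i : {linear N -> N'}),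
    injective i -> injective (@tensor_map R M N N' i).

Definition flat_dim_le (R : pzRingType) (n : nat) (M : rmodType R) : Prop :=
  exists P : resolution (@flat R) M,
    forall k, (n < k)%N -> trivial_module (P k).

(* The supremum of the flat dimensions of right modules is at most n. *)
Definition weak_gl_dim_le (R : pzRingType) (n : nat) : Prop :=
  forall M : rmodType R, flat_dim_le n M.

(* Complexes are indexed by int and the differential lowers degree.  Statements
   at every degree are written at i + 1, i : int, so that no transport along
   i - 1 + 1 = i is needed. *)
Section Complexes.
Variable S : pzRingType.

Record complex := Complex {
  cpx_obj :> int -> lmodType S;
  cpx_d : forall i : int, {linear cpx_obj (i + 1) -> cpx_obj i};
  cpx_dd : forall (i : int) (x : cpx_obj (i + 1 + 1)),
    cpx_d i (cpx_d (i + 1) x) = 0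
}.

Record chain_map (X Y : complex) := ChainMap {
  cm_fun :> forall i : int, {linear X i -> Y i};
  cm_comm : forall (i : int) (x : X (i + 1)),
    cm_fun i (cpx_d X i x) = cpx_d Y i (cm_fun (i + 1) x)
}.

Definition cm_id (X : complex) : chain_map X X :=
  @ChainMap X X (fun i => idfun : {linear X i -> X i}) (fun _ _ => erefl).

Lemma cm_zero_comm (X Y : complex) (i : int) (x : X (i + 1)) :
  (\0 : X i -> Y i) (cpx_d X i x) = cpx_d Y i ((\0 : X (i + 1) -> Y (i + 1)) x).
Proof. by rewrite /= linear0. Qed.

Definition cm_zero (X Y : complex) : chain_map X Y :=
  @ChainMap X Y (fun i => \0 : {linear X i -> Y i}) (@cm_zero_comm X Y).

Lemma cm_comp_comm (X Y Z : complex) (g : chain_map Y Z) (f : chain_map X Y)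
    (i : int) (x : X (i + 1)) :
  (g i \o f i) (cpx_d X i x) = cpx_d Z i ((g (i + 1) \o f (i + 1)) x).
Proof. by rewrite /= !cm_comm. Qed.

Definition cm_comp (X Y Z : complex) (g : chain_map Y Z) (f : chain_map X Y) :
    chain_map X Z :=
  @ChainMap X Z (fun i => g i \o f i : {linear X i -> Z i})
    (@cm_comp_comm X Y Z g f).

Definition homotopic (X Y : complex) (f g : chain_map X Y) : Prop :=
  exists h : forall i : int, {linear X i -> Y (i + 1)},
    forall (i : int) (x : X (i + 1)),
      f (i + 1) x - g (i + 1) x
      = cpx_d Y (i + 1) (h (i + 1) x) + h i (cpx_d X i x).

Definition is_cycle (X : complex) (i : int) (x : X (i + 1)) : Prop :=
  cpx_d X i x = 0.

Definition homologous (X : complex) (i : int) (x y : X (i + 1)) : Prop :=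
  exists z : X (i + 1 + 1), cpx_d X (i + 1) z = x - y.

(* H_n(f) is injective and surjective for every n. *)
Definition quasi_iso (X Y : complex) (f : chain_map X Y) : Prop :=
  forall i : int,
    (forall x x' : X (i + 1), is_cycle x -> is_cycle x' ->
       homologous (f (i + 1) x) (f (i + 1) x') -> homologous x x') /\
    (forall y : Y (i + 1), is_cycle y ->
       exists2 x : X (i + 1), is_cycle x & homologous (f (i + 1) x) y).

(* Morphisms X -> Y of D(S) are roofs X <- W -> Y with W -> X a
   quasi-isomorphism, modulo derived_eq: the calculus of fractions in the
   homotopy category.  The roof stands for dm_num o dm_den^-1. *)
Record derived_map (X Y : complex) := DerivedMap {
  dm_apex : complex;
  dm_den : chain_map dm_apex X;
  dm_den_qiso : quasi_iso dm_den;
  dm_num : chain_map dm_apex Y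
}.

Definition derived_eq (X Y : complex) (a b : derived_map X Y) : Prop :=
  exists (V : complex) (u : chain_map V (dm_apex a))
         (v : chain_map V (dm_apex b)),
    [/\ quasi_iso (cm_comp (dm_den a) u),
        homotopic (cm_comp (dm_den a) u) (cm_comp (dm_den b) v)
      & homotopic (cm_comp (dm_num a) u) (cm_comp (dm_num b) v)].

Lemma quasi_iso_id (X : complex) : quasi_iso (cm_id X).
Proof.
move=> i; split=> // y hy; exists y => //.
by exists 0; rewrite linear0 /= subrr.
Qed.

Definition derived_of (X Y : complex) (f : chain_map X Y) : derived_map X Y :=
  DerivedMap (@quasi_iso_id X) f.

Definition derived_zero (X Y : complex) : derived_map X Y :=
  derived_of (cm_zero X Y).

(* H_*(a) = 0: the class of x is sent to the class of dm_num w, where w is a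
   cycle of the apex whose image under dm_den is homologous to x. *)
Definition homology_zero (X Y : complex) (a : derived_map X Y) : Prop :=
  forall (i : int) (x : X (i + 1)) (w : dm_apex a (i + 1)),
    is_cycle x -> is_cycle w -> homologous (dm_den a (i + 1) w) x ->
    homologous (dm_num a (i + 1) w) 0.

Definition bounded (X : complex) : Prop :=
  exists n : nat, forall i : int, (n < `|i|)%N -> trivial_module (X i).

Definition perfect (X : complex) : Prop :=
  bounded X /\ forall i : int, finitely_generated (X i) /\ projective (X i).

End Complexes.

Definition generating_hypothesis (R : pzRingType) : Prop :=
  forall (X Y : complex R^c) (f : derived_map X Y),
    perfect X -> perfect Y -> homology_zero f ->
    derived_eq f (derived_zero X Y).

(* Main.v *)
From HB Require Import structures.
Require Import Defs.
From mathcomp Require Import all_boot all_order all_algebra.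
From mathcomp Require Import generic_quotient ring_quotient boolp functions.
From mathcomp.multinomials Require Import freeg.
From mathcomp Require Import zify.

(** Both conditions are equivalent to one splitting property of finitely
    generated projectives.  Given [u : A -> B], a complex [C -> D -> E] and
    [g : A -> D] landing in the cycles of [D] and mapping [ker u] into the
    boundaries, there are [h0 : B -> D], landing in the cycles, and [h1 : A -> C]
    with [g = h0 u + d2 h1].  Such a [g] is a ghost from the complex [A -> B] to
    [C -> D -> E], and [(h0, h1)] is a null-homotopy of it; conversely, the
    property yields a null-homotopy of a ghost between perfect complexes, one
    degree at a time from the bottom.

    The case [E = 0] says that the finitely presented module [D / im d2] is
    FP-injective.  The case [C = 0], [B = D], [g = u] gives an endomorphism [1 - h0] of [B]
    killing [im u] and not changing [d1]; this is the equational criterion for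
    the flatness of [im d1], and hence of submodules of free modules.  In the
    other direction, FP-injectivity of [D / im d2] gives [h0] up to the condition
    [d1 h0 = 0], and flatness of [im d1], obtained from the flat resolution of
    [E / im d1] by a Schanuel argument, provides the correction. *)

Set Implicit Arguments.
Unset Strict Implicit.
Unset Printing Implicit Defensive.

Import Order.TTheory GRing.Theory Num.Theory.
Local Open Scope ring_scope.
Local Open Scope quotient_scope.

(** * Submodules, quotients and projective modules *)

Section LinearMaps.
Variables (S : pzRingType) (A B : lmodType S).

Section Build.
Variables (f : A -> B) (hf : linear f).
Let g := f.
HB.instance Definition _ := GRing.isLinear.Build S A B *:%R g hf.
Definition to_linear : {linear A -> B} := g.
Lemma to_linearE x : to_linear x = f x. Proof. by []. Qed.
End Build.

Lemma addlinP (f g : {linear A -> B}) : linear (fun x => f x + g x).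
Proof. by move=> a x y; rewrite !linearP scalerDr addrACA. Qed.
Definition addlin f g : {linear A -> B} := to_linear (addlinP f g).

Lemma opplinP (f : {linear A -> B}) : linear (fun x => - f x).
Proof. by move=> a x y; rewrite linearP opprD scalerN. Qed.
Definition opplin f : {linear A -> B} := to_linear (opplinP f).

End LinearMaps.

(** Membership is a proposition, since kernels and images need not be decidable; [submodb] makes it
    boolean classically. *)
Record submod (S : pzRingType) (M : lmodType S) := Submod {
  submod_pred :> M -> Prop;
  submod0 : submod_pred 0;
  submodP : forall a x y, submod_pred x -> submod_pred y -> submod_pred (a *: x + y)
}.

Section Submodule.
Variables (S : pzRingType) (M : lmodType S) (U : submod M).

Definition submodb (x : M) : bool := `[< U x >].

Fact submodb_closed : submod_closed submodb.
Proof.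
split=> [|a x y /asboolP ux /asboolP uy]; apply/asboolP; first exact: submod0.
exact: submodP.
Qed.

Fact submodb_zmod_closed : zmod_closed submodb.
Proof. exact: GRing.submod_closedB submodb_closed. Qed.

HB.instance Definition _ := GRing.isZmodClosed.Build M submodb submodb_zmod_closed.

Record submod_type := SubmodElt { submod_val : M; _ : submodb submod_val }.
HB.instance Definition _ := [isSub for submod_val].
HB.instance Definition _ := [Choice of submod_type by <:].
HB.instance Definition _ := GRing.SubChoice_isSubLmodule.Build S M submodb
  submod_type (GRing.submod_closed_semi submodb_closed).

Definition submod_inc : {linear submod_type -> M} := val.

Lemma submod_valP (x : submod_type) : U (submod_inc x).
Proof. exact/asboolP/(valP x). Qed.

Lemma submod_inc_inj : injective submod_inc.
Proof. exact: val_inj. Qed.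

Lemma submod_incP x : U x -> exists y, submod_inc y = x.
Proof. by move=> /asboolP ux; exists (SubmodElt ux). Qed.

Section Lift.
Variables (A : lmodType S) (f : {linear A -> M}) (hf : forall x, U (f x)).
Let g x : submod_type := SubmodElt (asboolT (hf x)).
Fact submod_liftP : linear g.
Proof.
move=> a x y; apply: val_inj; rewrite -[LHS]/(f (a *: x + y)) linearP.
by rewrite -[RHS]/(submod_inc (a *: g x + g y)) linearP.
Qed.
Definition submod_lift : {linear A -> submod_type} := to_linear submod_liftP.
Lemma submod_liftE x : submod_inc (submod_lift x) = f x. Proof. by []. Qed.
End Lift.

Definition submod_zmod : zmodClosed M := GRing.ZmodClosed.clone _ submodb _.
Definition quo : Type := Quotient.quot submod_zmod.
HB.instance Definition _ := GRing.Zmodule.on quo.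
Definition quo_pi (x : M) : quo := \pi_(Quotient.quot submod_zmod) x.
Definition quo_repr (x : quo) : M := repr (x : Quotient.quot submod_zmod).

Lemma quo_piP x y : quo_pi x = quo_pi y <-> U (x - y).
Proof.
rewrite /quo_pi; split=> [/eqP|h]; first by rewrite -Quotient.idealrBE => /asboolP.
by apply/eqP; rewrite -Quotient.idealrBE; apply/asboolP.
Qed.

Lemma quo_pi_repr (x : quo) : quo_pi (quo_repr x) = x.
Proof. by rewrite /quo_pi /quo_repr reprK. Qed.

Lemma quo_piD x y : quo_pi (x + y) = quo_pi x + quo_pi y.
Proof. by rewrite /quo_pi raddfD. Qed.

Let scale a (x : quo) := quo_pi (a *: quo_repr x).

Fact quo_piZ a x : quo_pi (a *: x) = scale a (quo_pi x).
Proof.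
apply/quo_piP; rewrite -scalerBr -[_ *: _]addr0; apply: submodP (submod0 U).
by apply/quo_piP; rewrite quo_pi_repr.
Qed.

Fact quo_scalerA a b v : scale a (scale b v) = scale (a * b) v.
Proof. by rewrite -[v]quo_pi_repr -!quo_piZ scalerA. Qed.
Fact quo_scale1r : left_id 1 scale.
Proof. by move=> v; rewrite -[v]quo_pi_repr -!quo_piZ scale1r. Qed.
Fact quo_scalerDr : right_distributive scale +%R.
Proof.
by move=> a u v; rewrite -[u]quo_pi_repr -[v]quo_pi_repr -quo_piD -!quo_piZ scalerDr quo_piD.
Qed.
Fact quo_scalerDl v : {morph scale^~ v : a b / a + b}.
Proof. by move=> a b; rewrite /= -[v]quo_pi_repr -!quo_piZ scalerDl quo_piD. Qed.

HB.instance Definition _ := GRing.Zmodule_isLmodule.Build S quo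
  quo_scalerA quo_scale1r quo_scalerDr quo_scalerDl.

Definition quo_lmod : lmodType S := quo.

Fact quo_proj_linear : linear (quo_pi : M -> quo_lmod).
Proof. by move=> a x y; rewrite quo_piD quo_piZ. Qed.
Definition quo_proj : {linear M -> quo_lmod} := to_linear quo_proj_linear.

Lemma quo_proj_surj : surjective_map quo_proj.
Proof. by move=> x; exists (quo_repr x); exact: quo_pi_repr. Qed.

Lemma quo_proj_eq0 x : quo_proj x = 0 <-> U x.
Proof. by rewrite -(linear0 quo_proj) -[x in U x]subr0; exact: quo_piP. Qed.

Section Factor.
Variables (A : lmodType S) (f : {linear M -> A}) (hf : forall x, U x -> f x = 0).
Let g (x : quo_lmod) := f (quo_repr x).
Fact quo_factor_pi x : g (quo_proj x) = f x.
Proof.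
apply/eqP; rewrite /g -subr_eq0 -linearB; apply/eqP/hf/quo_piP.
exact: quo_pi_repr.
Qed.
Fact quo_factorP : linear g.
Proof.
move=> a x y; have [[x' <-] [y' <-]] := (quo_proj_surj x, quo_proj_surj y).
by rewrite -linearP !quo_factor_pi linearP.
Qed.
Definition quo_factor : {linear quo_lmod -> A} := to_linear quo_factorP.
Lemma quo_factorE x : quo_factor (quo_proj x) = f x.
Proof. exact: quo_factor_pi. Qed.
End Factor.

End Submodule.

Section KerIm.
Variables (S : pzRingType) (A B : lmodType S) (f : {linear A -> B}).

Fact ker0 : f 0 = 0. Proof. exact: linear0. Qed.
Fact kerP a x y : f x = 0 -> f y = 0 -> f (a *: x + y) = 0.
Proof. by move=> fx fy; rewrite linearP fx fy scaler0 addr0. Qed.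
Definition ker := Submod ker0 kerP.

Fact im0 : exists x, f x = 0. Proof. by exists 0; exact: linear0. Qed.
Fact imP a y y' : (exists x, f x = y) -> (exists x, f x = y') ->
  exists x, f x = a *: y + y'.
Proof. by move=> [x <-] [x' <-]; exists (a *: x + x'); rewrite linearP. Qed.
Definition im := @Submod _ _ (fun y => exists x, f x = y) im0 imP.
End KerIm.

Section Projective.
Variable S : pzRingType.

(** Corestricting [f] and [g] to the image of [f] makes [f] surjective, so projectivity applies.
    This form fits lifting along an exact sequence. *)
Lemma proj_lift (P A B : lmodType S) (f : {linear A -> B}) (g : {linear P -> B}) :
  projective P -> (forall x, exists y, f y = g x) ->
  exists h : {linear P -> A}, forall x, f (h x) = g x.
Proof.
move=> projP hg.
pose f' := submod_lift (U := im f) (f := f) (fun x => ex_intro _ x erefl).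
pose g' := submod_lift (U := im f) (f := g) hg.
have [|h hh] := projP _ _ f' g'.
  move=> y; have [x hx] := submod_valP y; exists x.
  by apply: submod_inc_inj; rewrite submod_liftE.
by exists h => x; rewrite -[f _]/(submod_inc (im f) (f' (h x))) hh.
Qed.

Section RowMap.
Variables (n : nat) (A : lmodType S) (a : 'I_n -> A).
Fact row_mapP : linear (fun x : 'rV[S]_n => \sum_i x 0 i *: a i).
Proof.
move=> c x y; rewrite scaler_sumr -big_split; apply: eq_bigr => i _ /=.
by rewrite !mxE scalerDl scalerA.
Qed.
Definition row_map : {linear 'rV[S]_n -> A} := to_linear row_mapP.
Lemma row_mapE x : row_map x = \sum_i x 0 i *: a i. Proof. by []. Qed.
Lemma row_map_delta i : row_map (delta_mx 0 i) = a i.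
Proof.
rewrite row_mapE (bigD1 i) //= mxE !eqxx scale1r big1 ?addr0 // => j ji.
by rewrite mxE (negbTE ji) scale0r.
Qed.
End RowMap.

Lemma row_lin_sum n (A : lmodType S) (f : {linear 'rV[S]_n -> A}) x :
  f x = \sum_i x 0 i *: f (delta_mx 0 i).
Proof.
by rewrite [in LHS](row_sum_delta x) linear_sum; apply: eq_bigr => i _; rewrite linearZ.
Qed.

Lemma eq_row_lin n (A : lmodType S) (f g : {linear 'rV[S]_n -> A}) :
  (forall i, f (delta_mx 0 i) = g (delta_mx 0 i)) -> f =1 g.
Proof.
by move=> fg x; rewrite !row_lin_sum; apply: eq_bigr => i _; rewrite fg.
Qed.

Lemma row_projective n : projective 'rV[S]_n.
Proof.
move=> A B p g surjp.
have [a ha] := choice (fun i : 'I_n => surjp (g (delta_mx 0 i))).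
exists (row_map a) => x; apply: (eq_row_lin (f := p \o row_map a)) => i.
by rewrite -[LHS]/(p (row_map a (delta_mx 0 i))) row_map_delta.
Qed.

Lemma row_fg n : finitely_generated 'rV[S]_n.
Proof. by exists n, idfun => y; exists y. Qed.

Lemma fg_proj_retract (P : lmodType S) : finitely_generated P -> projective P ->
  exists n (i : {linear P -> 'rV[S]_n}) (r : {linear 'rV[S]_n -> P}),
    forall x, r (i x) = x.
Proof.
move=> [n [r surjr]] projP; have [i hi] := projP _ _ r idfun surjr.
by exists n, i, r.
Qed.

End Projective.

(** * Complexes and ghosts *)

(** Degreewise construction from below. Conditions above [n] hold for every family, so finitely many
    steps suffice and no limit is taken. A step may replace the whole family, earlier entries
    included. *)
Lemma int_family_ind (T : int -> Type) (C : (forall i, T i) -> int -> Prop)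
    (n : nat) (s0 : forall i, T i) :
  (forall s i, i < - n%:Z -> C s i) -> (forall s i, n%:Z < i -> C s i) ->
  (forall s i, (forall j, j < i -> C s j) ->
     exists s', forall j, j <= i -> C s' j) ->
  exists s, forall i, C s i.
Proof.
move=> lo hi step.
have H (k : nat) : exists s, forall j, j < k%:Z - n%:Z -> C s j.
  elim: k => [|k [s /step [s' hs']]]; first by exists s0 => j hj; apply: lo; lia.
  by exists s' => j hj; apply: hs'; lia.
(* After [2n + 1] steps from [- n], all degrees up to [n] are settled. *)
have [s hs] := H (n + n).+1; exists s => i.
have [|] := ltP n%:Z i; first exact: hi.
by move=> hi'; apply: hs; lia.
Qed.

Section Perfect.
Variable S : pzRingType.
Implicit Types X Y V : complex S.

(** Section and homotopy are built together: up to signs, the pair is a null-homotopy of the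
    inclusion of [X] into the mapping cone of [q]. *)
Lemma qiso_section X V (q : chain_map V X) :
  perfect X -> quasi_iso q ->
  exists s : chain_map X V, homotopic (cm_comp q s) (cm_id X).
Proof.
move=> [bX fpX] qq.
pose T i := ({linear X i -> V i} * {linear X i -> X (i + 1)%R})%type.
pose Q (s : forall i, T i) (i : int) (x : X (i + 1)) :=
  (s i).1 (cpx_d X i x) = cpx_d V i ((s (i + 1)).1 x) /\
  q (i + 1) ((s (i + 1)).1 x) - x
    = cpx_d X (i + 1) ((s (i + 1)).2 x) + (s i).2 (cpx_d X i x).
pose s0 i : T i := (\0 : {linear _ -> _}, \0 : {linear _ -> _}).
have [s hs] : exists s, forall i x, @Q s i x.
  have [n hn] := bX.
  (* The equations at [i] concern [X (i + 1)], whence the bound [n.+1] in place of [n]. *)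
  apply: (@int_family_ind T (fun s i => forall x, @Q s i x) n.+1 s0).
  - move=> s i hi x; rewrite (hn (i + 1) _ x); last by lia.
    by rewrite /Q !linear0.
  - move=> s i hi x; rewrite (hn (i + 1) _ x); last by lia.
    by rewrite /Q !linear0.
  move=> s i; have -> : i = i - 1 + 1 by lia.
  move: (i - 1) => {}i hs.
  (* The lifting problem below is solvable since the mapping cone of [q] is
     acyclic. *)
  pose f (p : V (i + 1 + 1)%R * X (i + 1 + 1 + 1)%R) : V (i + 1)%R * X (i + 1 + 1)%R :=
    (cpx_d V _ p.1, q _ p.1 - cpx_d X _ p.2).
  have lf : linear f.
    move=> a x y; rewrite /f !linearP /=; congr (_, _).
    by rewrite addrACA -scalerDr.
  pose g (x : X (i + 1 + 1)) : V (i + 1)%R * X (i + 1 + 1)%R :=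
    ((s _).1 (cpx_d X _ x), x + (s _).2 (cpx_d X _ x)).
  have lg : linear g.
    move=> a x y; rewrite /g !linearP /=; congr (_, _).
    by rewrite addrACA -scalerDr.
  have [|h hh] := @proj_lift S _ _ _ (to_linear lf) (to_linear lg) (fpX _).2.
    move=> x; have [hs1 hs2] := hs i ltac:(lia) (cpx_d X _ x).
    set a := (s (i + 1)).1 _ in hs1 hs2.
    have da : cpx_d V _ a = 0 by rewrite -hs1 cpx_dd linear0.
    have qa : q _ a = cpx_d X _ (x + (s _).2 (cpx_d X _ x)).
      apply/eqP; rewrite linearD -subr_eq0 opprD addrA hs2 cpx_dd linear0.
      by rewrite addr0 subrr.
    (* Injectivity on homology bounds [a] by some [v0]; surjectivity then supplies a cycle [v1] such
       that [q (v0 - v1)] has the required value up to a boundary. *)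
    have [v0 dv0] : homologous a 0.
      apply: (qq i).1 => //; first exact: linear0.
      by rewrite linear0; exists (x + (s _).2 (cpx_d X _ x)); rewrite subr0 qa.
    rewrite subr0 in dv0.
    have [v1 dv1 [y dy]] : exists2 v1, is_cycle v1 &
        homologous (q _ v1) (q _ v0 - (x + (s _).2 (cpx_d X _ x))).
      by apply: (qq (i + 1)).2; rewrite /is_cycle linearB -cm_comm dv0 qa subrr.
    exists (v0 - v1, - y); rewrite !to_linearE /f /g /=.
    rewrite linearB dv0 dv1 subr0 linearN dy linearB opprK; congr (_, _).
    by rewrite opprB addrA addrNK addrC subrK.
  have lh1 : linear (fun x => (h x).1) by move=> a x y; rewrite linearP.
  have lh2 : linear (fun x => (h x).2) by move=> a x y; rewrite linearP.
  pose t : T (i + 1 + 1) := (to_linear lh1, to_linear lh2).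
  (* Only the entry at [i + 1 + 1] changes, and among the equations up to [i + 1] only the last one
     involves it. *)
  exists (dfwith s t) => j hj x; rewrite /Q.
  have [ej|nj] := eqVneq j (i + 1).
    subst j; rewrite dfwith_in dfwith_out; last by lia.
    have [e1 e2] : f (h x) = g x by exact: hh.
    split; first by rewrite -e1.
    apply/eqP; rewrite subr_eq; apply/eqP; move/eqP: e2; rewrite subr_eq => /eqP e2.
    have comm3 (Z : zmodType) (a b c : Z) : a + b + c = c + b + a.
      by rewrite addrC (addrC a) addrA.
    by rewrite -[LHS]/(q _ (h x).1) e2; exact: comm3.
  rewrite !dfwith_out; [apply: hs| |]; lia.
have cs i x : (s i).1 (cpx_d X i x) = cpx_d V i ((s (i + 1)).1 x) := (hs i x).1.
by exists (ChainMap cs), (fun i => (s i).2) => i x; have [] := hs i x.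
Qed.

Definition ghost_split (A B C D E : lmodType S) : Prop :=
  forall (u : {linear A -> B}) (d2 : {linear C -> D}) (d1 : {linear D -> E})
      (g : {linear A -> D}),
    (forall x, d1 (d2 x) = 0) -> (forall x, d1 (g x) = 0) ->
    (forall x, u x = 0 -> exists y, d2 y = g x) ->
  exists (h0 : {linear B -> D}) (h1 : {linear A -> C}),
    (forall x, g x = h0 (u x) + d2 (h1 x)) /\ (forall x, d1 (h0 x) = 0).

(** Conjugating by the inclusions and retractions of finite free modules preserves the hypotheses,
    and the resulting [h0], [h1] are compressed back to the summands. *)
Lemma ghost_split_retract A B C D E :
  (forall a b c d e, ghost_split 'rV[S]_a 'rV[S]_b 'rV[S]_c 'rV[S]_d 'rV[S]_e) ->
  finitely_generated A -> projective A -> finitely_generated B -> projective B ->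
  finitely_generated C -> projective C -> finitely_generated D -> projective D ->
  finitely_generated E -> projective E -> ghost_split A B C D E.
Proof.
move=> gs fA pA fB pB fC pC fD pD fE pE u d2 d1 g d12 d1g gu.
have [a [iA [rA kA]]] := fg_proj_retract fA pA.
have [b [iB [rB kB]]] := fg_proj_retract fB pB.
have [c [iC [rC kC]]] := fg_proj_retract fC pC.
have [d [iD [rD kD]]] := fg_proj_retract fD pD.
have [e [iE [rE kE]]] := fg_proj_retract fE pE.
have [| | |h0 [h1 [hg hh]]] := gs a b c d e (iB \o u \o rA) (iD \o d2 \o rC)
  (iE \o d1 \o rD) (iD \o g \o rA).
- by move=> x /=; rewrite kD d12 linear0.
- by move=> x /=; rewrite kD d1g linear0.
- move=> x /= ux; have [|y dy] := gu (rA x); first by rewrite -(kB (u _)) ux linear0.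
  by exists (iC y); rewrite kC dy.
exists (rD \o h0 \o iB), (rC \o h1 \o iA); split=> x /=.
  by have /= := hg (iA x); rewrite kA => /(congr1 rD); rewrite linearD !kD.
by rewrite -(kE (d1 _)) -[iE _]/((iE \o d1 \o rD) (h0 (iB x))) hh linear0.
Qed.

Definition ghost X Y (f : chain_map X Y) : Prop :=
  forall i (x : X (i + 1)), is_cycle x -> homologous (f (i + 1) x) 0.

(** The obstruction in degree [i + 1 + 1] is [g = f - h d]: it lands in cycles by the equation one
    degree below, and on cycles it equals [f], whose values there are boundaries. Splitting [g]
    gives the next component [h1] and a correction [h0] of the previous one. *)
Lemma ghost_null X Y (f : chain_map X Y) :
  (forall i j k l m, ghost_split (X i) (X j) (Y k) (Y l) (Y m)) ->
  perfect X -> ghost f -> homotopic f (cm_zero X Y).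
Proof.
move=> gs [[n hn] fpX] gf.
pose T i := {linear X i -> Y (i + 1)}.
pose Q (h : forall i, T i) (i : int) (x : X (i + 1)) :=
  f (i + 1) x = cpx_d Y (i + 1) (h (i + 1) x) + h i (cpx_d X i x).
suff [h hh] : exists h, forall i x, @Q h i x.
  by exists h => i x; rewrite subr0; exact: hh.
apply: (@int_family_ind T (fun s i => forall x, @Q s i x) n.+1 (fun=> \0)).
- by move=> s i hi x; rewrite (hn (i + 1) _ x) /Q ?linear0 ?addr0 //; lia.
- by move=> s i hi x; rewrite (hn (i + 1) _ x) /Q ?linear0 ?addr0 //; lia.
move=> h i; have -> : i = i - 1 + 1 by lia.
move: (i - 1) => {}i hh.
have hi x : f (i + 1) (cpx_d X _ x) = cpx_d Y (i + 1) (h (i + 1) (cpx_d X _ x)).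
  by rewrite (hh i) ?cpx_dd ?linear0 ?addr0 //; lia.
pose g := addlin (f (i + 1 + 1)) (opplin (h (i + 1) \o cpx_d X (i + 1))).
have [| | |h0 [h1 [hg dh0]]] :=
    gs _ _ _ _ _ (cpx_d X (i + 1)) (cpx_d Y (i + 1 + 1)) (cpx_d Y (i + 1)) g.
- exact: cpx_dd.
- by move=> x; rewrite /g /= linearB -cm_comm hi subrr.
- move=> x dx; have [y dy] := gf _ x dx; exists y.
  have {}dx : cpx_d X _ x = 0 := dx.
  by rewrite dy /g /= dx [h _ 0]linear0 oppr0 !addr0.
(* Degree [i + 1] is corrected by [h0], which does not affect the lower
   equations because [h0] lands in cycles. *)
pose h' : forall j, T j := dfwith h (addlin (h (i + 1)) h0 : T (i + 1)).
exists (dfwith h' (h1 : T (i + 1 + 1))) => j hj x; rewrite /Q.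
have [ej|nj] := eqVneq j (i + 1).
  subst j; rewrite dfwith_in dfwith_out; last by lia.
  rewrite /h' dfwith_in /addlin to_linearE.
  have := hg x; rewrite /g /= => /eqP; rewrite subr_eq => /eqP ->.
  have comm3 (Z : zmodType) (a b c : Z) : a + b + c = b + (c + a).
    by rewrite addrAC addrC (addrC a).
  exact: comm3.
rewrite dfwith_out; last by lia.
rewrite [dfwith _ _ j]dfwith_out; last by lia.
rewrite [h' j]dfwith_out; last by lia.
have [ej|nj'] := eqVneq j i; last by rewrite /h' dfwith_out; [apply: hh|]; lia.
subst j; rewrite /h' dfwith_in /addlin to_linearE linearD dh0 addr0.
by apply: hh; lia.
Qed.


(** A homotopy section [s] of the denominator replaces the roof by the chain map [dm_num f] after
    [s], a null-homotopic ghost. The common refinement of the two roofs is then [X] itself, through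
    [s] and the identity. *)
Lemma ghost_derived_null X Y (f : derived_map X Y) :
  (forall A B C D E : lmodType S,
    finitely_generated A -> projective A -> finitely_generated B -> projective B ->
    finitely_generated C -> projective C -> finitely_generated D -> projective D ->
    finitely_generated E -> projective E -> ghost_split A B C D E) ->
  perfect X -> perfect Y -> homology_zero f -> derived_eq f (derived_zero X Y).
Proof.
move=> gs pX pY hf; have [s hs] := qiso_section pX (dm_den_qiso f).
have [h hh] := hs.
have homol i x : is_cycle x -> homologous (dm_den f (i + 1) (s (i + 1) x)) x.
  move=> dx; exists (h (i + 1) x).
  by have := hh i x; rewrite (dx : cpx_d X _ x = 0) linear0 addr0 => <-.
have cyc i (x : X (i + 1)) : is_cycle x -> is_cycle (s (i + 1) x).
  by move=> dx; rewrite /is_cycle -cm_comm dx linear0.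
have gn : homotopic (cm_comp (dm_num f) s) (cm_zero X Y).
  apply: ghost_null => // [i j k l m|i x dx].
    by apply: gs; [case: (pX.2 i)|case: (pX.2 i)|case: (pX.2 j)|case: (pX.2 j)
      |case: (pY.2 k)|case: (pY.2 k)|case: (pY.2 l)|case: (pY.2 l)
      |case: (pY.2 m)|case: (pY.2 m)].
  by apply: hf; [exact: dx|exact: cyc|exact: homol].
exists X, s, (cm_id X); split=> //.
move=> i; split=> [x x' dx dx' [y dy]|y dy]; last first.
  by exists y => //; exact: homol.
(* On cycles [dm_den f] after [s] differs from the identity by [d h], so a chain bounding the
   difference of the images is corrected by the values of [h]. *)
exists (y - (h (i + 1) x - h (i + 1) x')).
rewrite linearB dy linearB.
have := hh i x; have := hh i x'; rewrite (dx : cpx_d X _ x = 0) (dx' : cpx_d X _ x' = 0).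
rewrite !linear0 !addr0 /= => <- <-.
have sub4 (Z : zmodType) (a b c d : Z) : a - b - ((a - c) - (b - d)) = c - d.
  by rewrite opprB !addrA subrK opprB addrC !addrA subrK.
exact: sub4.
Qed.

End Perfect.

(** * Three-term complexes as test objects for the generating hypothesis *)

Section ThreeTerm.
Variables (S : pzRingType).

Section Complex.
Variables (C D E : lmodType S) (d2 : {linear C -> D}) (d1 : {linear D -> E}).
Hypothesis d12 : forall x, d1 (d2 x) = 0.

(** Matching on numerals lets [cpx3_obj (i + 1)] compute, so that [d1] and [d2] fit in without
    transport. *)
Definition cpx3_obj (i : int) : lmodType S :=
  match i with 0%:Z => E | 1%:Z => D | 2%:Z => C | _ => 'rV[S]_0 end.

Definition cpx3_d (i : int) : {linear cpx3_obj (i + 1) -> cpx3_obj i} :=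
  match i return {linear cpx3_obj (i + 1) -> cpx3_obj i} with
  | 0%:Z => d1 | 1%:Z => d2 | _ => \0 end.

Lemma cpx3_dd i (x : cpx3_obj (i + 1 + 1)) : cpx3_d i (cpx3_d (i + 1) x) = 0.
Proof. by case: i x => [[|[|n]]|n] x //=; rewrite ?linear0 ?d12. Qed.

Definition cpx3 : complex S := Complex cpx3_dd.

Lemma cpx3_perfect :
  (finitely_generated C /\ projective C) -> (finitely_generated D /\ projective D) ->
  (finitely_generated E /\ projective E) -> perfect cpx3.
Proof.
move=> pC pD pE; split; last first.
  by case=> [[|[|[|n]]]|n] //=; (split; [exact: row_fg|exact: row_projective]).
by exists 2 => -[[|[|[|n]]]|n] //= _ x; rewrite thinmx0.
Qed.
End Complex.

End ThreeTerm.

Lemma generating_ghost_split (R : pzRingType) (A B C D E : rmodType R) :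
  generating_hypothesis R ->
  finitely_generated A -> projective A -> finitely_generated B -> projective B ->
  finitely_generated C -> projective C -> finitely_generated D -> projective D ->
  finitely_generated E -> projective E -> ghost_split A B C D E.
Proof.
move=> gh fA pA fB pB fC pC fD pD fE pE u d2 d1 g d12 d1g gu.
pose z : {linear 'rV[R^c]_0 -> A} := \0.
have uz x : u (z x) = 0 by rewrite linear0.
pose X := cpx3 uz; pose Y := cpx3 d12.
have pX : perfect X.
  by apply: cpx3_perfect; split=> //; [exact: row_fg|exact: row_projective].
have pY : perfect Y by exact: cpx3_perfect.
pose f i : {linear X i -> Y i} :=
  match i return {linear X i -> Y i} with 1%:Z => g | _ => \0 end.
have cf i x : f i (cpx_d X i x) = cpx_d Y i (f (i + 1) x).
  case: i x => [[|[|n]]|n] x; rewrite /= ?linear0 ?d1g //.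
pose F := ChainMap cf.
have f0 i x : i != 1 -> f i x = 0 by case: i x => [[|[|n]]|n].
have gF : homology_zero (derived_of F).
  move=> i x w dx dw _; have [i0|i0] := eqVneq i 0.
    subst i; have [y dy] := gu w dw; exists y; rewrite subr0; exact: dy.
  by exists 0; rewrite subr0 linear0; apply/esym/f0; lia.
have [V [v [w [qv vw fv]]]] := gh X Y (derived_of F) pX pY gF.
(* Equality in the derived category makes [F] null only after precomposition with the
   quasi-isomorphism [v]. Its section [s], with homotopy [k], yields the null-homotopy [h s - F k]
   of [F] itself. *)
have [s [k hk]] := qiso_section pX qv.
have [h hh] := fv.
pose H i : {linear X i -> Y (i + 1)} :=
  addlin (h i \o s i) (opplin (F (i + 1) \o k i)).
have hH i (x : X (i + 1)) : F (i + 1) x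
   = cpx_d Y (i + 1) (H (i + 1) x) + H i (cpx_d X i x).
  have /= := hh i (s (i + 1) x); rewrite subr0 -cm_comm => e1.
  have := congr1 (F (i + 1)) (hk i x); rewrite linearB [F _ (_ + _)]linearD.
  rewrite [F _ (cm_comp _ _ _ _)]e1 [F _ (cpx_d _ _ _)]cm_comm.
  rewrite -[cpx3_d d2 d1 (i + 1)]/(cpx_d Y (i + 1)) [cpx_d _ _ (_ - _)]linearB.
  have move_sub (Z : zmodType) (a b c d e : Z) :
      a + b - e = c + d -> e = (a - c) + (b - d).
    by move=> abe; rewrite addrACA -opprD -abe opprB addrC subrK.
  exact: move_sub.
exists (H 0), (H 1); split=> x.
  have /= e := hH 0 x; rewrite addrC; exact: e.
(* [Negz 0] is [-1], whose equation lives in degree 0. There [F] vanishes and the source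
   differential is zero. *)
have e : 0 = d1 (H 0 x) + H (Negz 0) 0 := hH (Negz 0) x.
by rewrite e linear0 addr0.
Qed.

(** * FP-injectivity *)

Lemma exact_lift (S : pzRingType) (A B C : lmodType S)
    (f : {linear A -> B}) (g : {linear B -> C}) y :
  exact_at f g -> g y = 0 -> exists x, f x = y.
Proof. by move=> fg /(fg y). Qed.

Lemma exact_comp0 (S : pzRingType) (A B C : lmodType S)
    (f : {linear A -> B}) (g : {linear B -> C}) x :
  exact_at f g -> g (f x) = 0.
Proof. by move=> fg; apply/fg; exists x. Qed.

(** The splitting extends cocycles along the presentation [u] of [F]. The comparison maps [al0],
    [al1] and [be0] carry this over to an arbitrary projective resolution [P]. *)
Lemma ghost_split_FP_injective (S : pzRingType) (M : lmodType S) :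
  (forall a b c d e, ghost_split 'rV[S]_a 'rV[S]_b 'rV[S]_c 'rV[S]_d 'rV[S]_e) ->
  finitely_presented M -> FP_injective M.
Proof.
move=> gs [c [d [d2 [q [exM surjq]]]]] F [a [b [u [p [exF surjp]]]]] P f fd.
have [al0 hal0] := row_projective p (res_aug_surj P).
have [|al1 hal1] := @proj_lift _ _ _ _ (res_d P 0) (al0 \o u) (@row_projective _ a).
  by move=> x; apply: (exact_lift (@res_exact0 _ _ _ P)); rewrite /= hal0 (exact_comp0 _ exF).
have [g hg] := row_projective (f \o al1) surjq.
have f0 x : res_d P 0 x = 0 -> f x = 0.
  by move=> dx; have [y <-] := exact_lift (@res_exactS _ _ _ P 0) dx; exact: fd.
have [| | |h0 [h1 [gh _]]] := gs a b c d 0 u d2 \0 g.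
- by [].
- by [].
- move=> x ux; apply: (exact_lift exM); rewrite hg /= f0 // hal1 /= ux linear0 //.
have [be0 hbe0] := res_class P 0 _ _ p (res_aug P) surjp.
(* Since [al0 be0] covers the identity of [F], the difference [r] lands in the kernel of the
   augmentation and lifts to [P 1]. *)
pose r := addlin idfun (opplin (al0 \o be0)).
have [|s hs] := @proj_lift _ _ _ _ (res_d P 0) r (res_class P 0).
  move=> x; apply: (exact_lift (@res_exact0 _ _ _ P)).
  by rewrite /r to_linearE linearB /= hal0 hbe0 subrr.
exists (addlin (q \o h0 \o be0) (f \o s)) => y; rewrite to_linearE /=.
have [|z uz] := exact_lift (y := be0 (res_d P 0 y)) exF.
  by rewrite hbe0 (exact_comp0 _ (@res_exact0 _ _ _ P)).
have e1 : q (h0 (be0 (res_d P 0 y))) = f (al1 z).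
  by rewrite -[RHS]hg gh uz linearD (exact_comp0 _ exM) addr0.
(* [s (d y) + al1 z] and [y] have the same image in [P 0], and [f] kills the kernel of
   [P 1 -> P 0]. *)
have : f (s (res_d P 0 y) + al1 z - y) = 0.
  apply: f0; rewrite linearB linearD hs /r to_linearE /= hal1 /= uz.
  by rewrite subrK subrr.
by move/eqP; rewrite linearB linearD subr_eq0 e1 addrC => /eqP.
Qed.

(** * Free modules on arbitrary sets, as finitely supported functions *)

Section FreeModule.
Variables (S : pzRingType) (T : eqType).

Definition covers (s : seq T) (f : T -> S) := forall t, t \notin s -> f t = 0.

Fact finite_support0 : exists s, covers s 0. Proof. by exists [::]. Qed.

Fact finite_supportP (a : S) (f g : T -> S^o) :
  (exists s, covers s f) -> (exists s, covers s g) ->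
  exists s, covers s (a *: f + g).
Proof.
move=> [s hs] [s' hs']; exists (s ++ s') => t; rewrite mem_cat negb_or => /andP[ts ts'].
by rewrite addrfctE scalrfctE hs // hs' // scaler0 addr0.
Qed.

Definition finite_support : submod (T -> S^o) :=
  @Submod _ (T -> S^o) (fun f => exists s, covers s f) finite_support0 finite_supportP.

Definition free_mod : lmodType S := submod_type finite_support.

Definition free_coef (f : free_mod) (t : T) : S := submod_inc finite_support f t.

Lemma free_coefP a f g t : free_coef (a *: f + g) t = a * free_coef f t + free_coef g t.
Proof. by rewrite /free_coef linearP addrfctE scalrfctE. Qed.

(** A chosen finite list that may be larger than the true support; [covers_sum] shows that sums do
    not depend on this choice. *)
Definition support (f : free_mod) : seq T := undup (projT1 (cid (submod_valP f))).

Lemma support_uniq f : uniq (support f). Proof. exact: undup_uniq. Qed.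

Lemma support_covers f : covers (support f) (free_coef f).
Proof.
move=> t; rewrite /support; case: (cid _) => s hs /=; rewrite mem_undup.
exact: hs.
Qed.

Lemma covers_sum (A : lmodType S) (a : T -> A) (f : T -> S) s s' :
  uniq s -> uniq s' -> covers s f -> covers s' f ->
  \sum_(t <- s) f t *: a t = \sum_(t <- s') f t *: a t.
Proof.
move=> us us' cs cs'.
have E r : \sum_(t <- r) f t *: a t = \sum_(t <- [seq t <- r | f t != 0]) f t *: a t.
  rewrite big_filter [LHS](bigID (fun t => f t != 0)) /= [X in _ + X]big1 ?addr0 //.
  by move=> t /negPn /eqP ->; rewrite scale0r.
rewrite E [RHS]E; apply/perm_big/uniq_perm; rewrite ?filter_uniq // => t.
rewrite !mem_filter; case: eqP => //= ft.
by rewrite -[t \in s]negbK -[t \in s']negbK; congr (~~ _);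
  apply/idP/idP => ht; [case: ft; exact: cs|case: ft; exact: cs'].
Qed.

Section Lin.
Variables (A : lmodType S) (a : T -> A).
Let ev (f : free_mod) := \sum_(t <- support f) free_coef f t *: a t.

Lemma free_evE f s : uniq s -> covers s (free_coef f) ->
  ev f = \sum_(t <- s) free_coef f t *: a t.
Proof.
by move=> us cs; apply: covers_sum => //; [exact: support_uniq|exact: support_covers].
Qed.

Fact free_linP : linear ev.
Proof.
move=> c f g; pose s := undup (support f ++ support g).
have us : uniq s by exact: undup_uniq.
have cf : covers s (free_coef f).
  by move=> t; rewrite mem_undup mem_cat negb_or => /andP[/support_covers].
have cg : covers s (free_coef g).
  by move=> t; rewrite mem_undup mem_cat negb_or => /andP[_ /support_covers].
rewrite (free_evE us cf) (free_evE us cg) (@free_evE _ s) //.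
  rewrite scaler_sumr -big_split; apply: eq_bigr => t _ /=.
  by rewrite free_coefP scalerDl scalerA.
by move=> t ts; rewrite free_coefP cf // cg // mulr0 addr0.
Qed.
Definition free_lin : {linear free_mod -> A} := to_linear free_linP.
End Lin.

Fact basis_support t : exists s, covers s (fun t' => (t' == t)%:R : S).
Proof. by exists [:: t] => t'; rewrite inE => /negbTE ->. Qed.

Definition free_basis t : free_mod :=
  @SubmodElt _ _ finite_support _ (asboolT (basis_support t)).

Lemma free_lin_basis (A : lmodType S) (a : T -> A) t : free_lin a (free_basis t) = a t.
Proof.
rewrite /free_lin to_linearE (@free_evE _ _ _ [:: t]) //.
  by rewrite big_seq1 /free_coef /= eqxx scale1r.
by move=> t'; rewrite inE /free_coef /= => /negbTE ->.
Qed.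

Lemma free_sum f s : uniq s -> covers s (free_coef f) ->
  f = \sum_(t <- s) free_coef f t *: free_basis t.
Proof.
move=> us cs; apply: submod_inc_inj; apply/funext => t.
have lc : linear (fun g => free_coef g t : S^o) by move=> b g h; exact: free_coefP.
rewrite -[RHS]/(to_linear lc _) linear_sum -[LHS]/(free_coef f t).
under eq_bigr => t' _ do rewrite linearZ to_linearE {2}/free_coef /=.
have [ts|ts] := boolP (t \in s); last first.
  rewrite cs // big1_seq // => t' /= t's.
  by rewrite (_ : t == t' = false) ?scaler0 //; apply: contraNF ts => /eqP ->.
rewrite (bigD1_seq t) //= eqxx big1 ?addr0; first by rewrite [RHS]mulr1.
by move=> t' /negbTE tt'; rewrite eq_sym tt' scaler0.
Qed.

Lemma eq_free_lin (A : lmodType S) (g h : {linear free_mod -> A}) :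
  (forall t, g (free_basis t) = h (free_basis t)) -> g =1 h.
Proof.
move=> gh f; rewrite (free_sum (support_uniq f) (@support_covers f)) !linear_sum.
by apply: eq_bigr => t _; rewrite !linearZ gh.
Qed.

Lemma free_projective : projective free_mod.
Proof.
move=> A B p g surjp; have [a ha] := choice (fun t => surjp (g (free_basis t))).
exists (free_lin a); apply: (eq_free_lin (g := p \o free_lin a)) => t.
by rewrite -[LHS]/(p (free_lin a (free_basis t))) free_lin_basis.
Qed.

(** The images of the [k] generators involve finitely many basis elements, which span a free summand
    of finite rank; [r] reads off those coefficients. *)
Lemma free_finite_retract k (x : {linear 'rV[S]_k -> free_mod}) :
  exists m (r : {linear free_mod -> 'rV[S]_m}) (i : {linear 'rV[S]_m -> free_mod}),
    forall y, i (r (x y)) = x y.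
Proof.
pose s := undup (flatten [seq support (x (delta_mx 0 j)) | j <- enum 'I_k]).
pose rf (f : free_mod) : 'rV[S]_(size s) := \row_j free_coef f (tnth (in_tuple s) j).
have lr : linear rf.
  by move=> a f g; apply/rowP => j; rewrite !mxE free_coefP.
exists (size s), (to_linear lr), (row_map (fun j => free_basis (tnth (in_tuple s) j))).
apply: (eq_row_lin (f := row_map _ \o to_linear lr \o x)) => j.
rewrite [RHS](@free_sum _ s) ?undup_uniq //; last first.
  move=> t ts; apply: support_covers; apply: contraNN ts => tj.
  by rewrite mem_undup; apply/flatten_mapP; exists j; rewrite ?mem_enum.
rewrite [LHS]row_mapE [RHS]big_tnth; apply: eq_bigr => l _.
by rewrite mxE.
Qed.

End FreeModule.

Lemma free_cover_surj (S : pzRingType) (M : lmodType S) :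
  surjective_map (free_lin (id : M -> M)).
Proof. by move=> x; exists (free_basis S x); exact: free_lin_basis. Qed.

(** * Extending a presentation to a projective resolution *)

Section ExtendResolution.
Variables (S : pzRingType).

(** Bundling source and target allows recursion on arrows; the target of [next_arrow f] is the
    source of [f] by computation, so differentials compose without transport. *)
Record arrow := Arrow {
  arrow_src : lmodType S; arrow_tgt : lmodType S;
  arrow_fun : {linear arrow_src -> arrow_tgt}
}.

Definition next_arrow (f : arrow) : arrow :=
  Arrow (submod_inc (ker (arrow_fun f))
    \o free_lin (id : submod_type (ker (arrow_fun f)) -> _)).

Fixpoint arrows (f : arrow) (n : nat) : arrow :=
  if n is n'.+1 then next_arrow (arrows f n') else f.

Lemma next_arrow_exact f : exact_at (arrow_fun (next_arrow f)) (arrow_fun f).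
Proof.
move=> y; split=> [fy|[x <-]].
  have [z hz] := submod_incP (U := ker (arrow_fun f)) fy.
  by have [x hx] := free_cover_surj z; exists x; rewrite -hz -hx.
exact: (submod_valP (U := ker (arrow_fun f))).
Qed.

Section Resolution.
Variables (A B F : lmodType S) (u : {linear A -> B}) (p : {linear B -> F}).
Hypotheses (projA : projective A) (projB : projective B).
Hypotheses (exact_up : exact_at u p) (surjp : surjective_map p).

Let obj n := arrow_tgt (arrows (Arrow u) n).

Fact extend_resolution_class n : projective (obj n).
Proof. by case: n => [|[|n]] //; exact: free_projective. Qed.

Definition extend_resolution : resolution (@projective S) F :=
  @Resolution S (@projective S) F obj extend_resolution_class
    (fun n => arrow_fun (arrows (Arrow u) n)) p surjp exact_up
    (fun n => @next_arrow_exact (arrows (Arrow u) n)).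
End Resolution.

(** With [u] as the bottom of a resolution of its cokernel, a map killing [ker u] is a cocycle in
    degree 1, hence a coboundary. *)
Lemma FP_injective_extend (M : lmodType S) a b (u : {linear 'rV[S]_a -> 'rV[S]_b})
    (f : {linear 'rV[S]_a -> M}) :
  FP_injective M -> (forall x, u x = 0 -> f x = 0) ->
  exists g : {linear 'rV[S]_b -> M}, forall x, f x = g (u x).
Proof.
move=> injM fu; pose p := quo_proj (im u).
have up : exact_at u p by move=> y; exact: quo_proj_eq0.
have sp : surjective_map p by exact: quo_proj_surj.
have fpF : finitely_presented (quo_lmod (im u)) by exists a, b, u, p.
pose P := extend_resolution (@row_projective S a) (@row_projective S b) up sp.
apply: (injM _ fpF P f) => x; apply: fu; exact: (exact_comp0 x (@next_arrow_exact (Arrow u))).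
Qed.
End ExtendResolution.

(** This is the equational criterion for flatness of [im w], with maps from free modules to [im w]
    lifted through [w]. *)
Definition flat_lifting (S : pzRingType) : Prop :=
  forall a b d e (u : {linear 'rV[S]_a -> 'rV[S]_b})
    (k : {linear 'rV[S]_b -> 'rV[S]_d}) (w : {linear 'rV[S]_d -> 'rV[S]_e}),
  (forall x, w (k (u x)) = 0) ->
  exists l : {linear 'rV[S]_b -> 'rV[S]_d},
    (forall x, l (u x) = 0) /\ (forall x, w (l x) = w (k x)).

(** FP-injectivity of [D / im d2] gives [k] with [g - k u = d2 h1]. Then [d1 k u = 0], and
    subtracting the [l] provided by [flat_lifting] makes [d1 (k - l) = 0] while keeping [k u]. *)
Lemma FP_injective_ghost_split (S : pzRingType) :
  (forall M : lmodType S, finitely_presented M -> FP_injective M) ->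
  flat_lifting S ->
  forall a b c d e, ghost_split 'rV[S]_a 'rV[S]_b 'rV[S]_c 'rV[S]_d 'rV[S]_e.
Proof.
move=> fpi fl a b c d e u d2 d1 g d12 d1g gu.
pose q := quo_proj (im d2).
have exq : exact_at d2 q by move=> y; exact: quo_proj_eq0.
have fpN : finitely_presented (quo_lmod (im d2)).
  by exists c, d, d2, q; split=> //; exact: quo_proj_surj.
have [|k0 hk0] := @FP_injective_extend _ _ a b u (q \o g) (fpi _ fpN).
  by move=> x /gu [y /= <-]; exact: exact_comp0 exq.
have [k hk] := row_projective k0 (@quo_proj_surj _ _ (im d2)).
have [|h1 hh1] := proj_lift (f := d2) (g := addlin g (opplin (k \o u))) (@row_projective _ a).
  move=> x; apply: (exact_lift exq); rewrite -[addlin _ _ x]/(g x - k (u x)) linearB [q (k _)]hk.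
  by rewrite -[q (g x)]/((q \o g) x) hk0 subrr.
have [|l [lu wl]] := fl _ _ _ _ u k d1.
  move=> x; have := congr1 d1 (hh1 x); rewrite d12 to_linearE /= linearB d1g sub0r.
  by move=> /eqP; rewrite eq_sym oppr_eq0 => /eqP.
exists (addlin k (opplin l)), h1; split=> x; rewrite to_linearE.
  by rewrite hh1 to_linearE /= lu subr0 addrC subrK.
by rewrite linearB wl subrr.
Qed.

(** * Tensor products and the equational criterion for flatness *)

Lemma freeg_subgroup_ind (K : choiceType) (P : {freeg K} -> Prop) :
  P 0 -> (forall x y, P x -> P y -> P (x - y)) -> (forall k, P << k >>) ->
  forall x, P x.
Proof.
move=> P0 PB PU x.
have PD y z : P y -> P z -> P (y + z).
  by move=> hy hz; rewrite -[z]opprK; apply: (PB) => //; rewrite -sub0r; exact: PB.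
rewrite -(freeg_sumE x); elim/big_ind: _ => // k _.
rewrite -[coeff k x]intz -freegU_mulz; case: (coeff k x) => n.
  by rewrite -pmulrn; elim: n => [|n IHn]; rewrite ?mulr0n // mulrS; apply: (PD).
rewrite NegzE mulrNz -sub0r; apply: (PB) => //.
by rewrite -pmulrn; elim: n => [|n IHn]; rewrite ?mulr1n // mulrS; apply: (PD).
Qed.

Section Lift.
Variables (K : choiceType) (V : zmodType) (f : K -> V).
Definition freeg_lift (x : {freeg K}) : V := fglift (f : K -> zmodule V) x.
Lemma freeg_liftU k : freeg_lift << k >> = f k.
Proof. by rewrite /freeg_lift liftU scale1r. Qed.
Lemma freeg_liftB x y : freeg_lift (x - y) = freeg_lift x - freeg_lift y.
Proof. exact: (@lift_is_additive _ _ (zmodule V) f x y). Qed.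
Lemma freeg_lift0 : freeg_lift 0 = 0.
Proof. by rewrite -[in LHS](subrr (0 : {freeg K})) freeg_liftB subrr. Qed.
End Lift.

Section TensorTheory.
Variables (R : pzRingType) (M : rmodType R) (N : lmodType R).

Lemma tensor_piB x y : tensor_pi (M := M) (N := N) (x - y) = tensor_pi x - tensor_pi y.
Proof. by rewrite /tensor_pi raddfB. Qed.

Lemma tensor_pi_eq0 x : tensor_pi (M := M) (N := N) x = 0 <-> tensor_rel x.
Proof.
rewrite -(subrr (tensor_pi 0)) -tensor_piB subrr tensor_piP subr0.
by [].
Qed.

Lemma tmulDl m m' n : tmul (M := M) (N := N) (m + m') n = tmul m n + tmul m' n.
Proof.
apply/eqP; rewrite -subr_eq0 opprD addrA -!tensor_piB; apply/eqP/tensor_pi_eq0.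
exact: TensorRelDl.
Qed.

Lemma tmulDr m n n' : tmul (M := M) (N := N) m (n + n') = tmul m n + tmul m n'.
Proof.
apply/eqP; rewrite -subr_eq0 opprD addrA -!tensor_piB; apply/eqP/tensor_pi_eq0.
exact: TensorRelDr.
Qed.

Lemma tmulZ m (r : R) n : tmul (M := M) (N := N) ((r : R^c) *: m) n = tmul m (r *: n).
Proof.
apply/eqP; rewrite -subr_eq0 -!tensor_piB; apply/eqP/tensor_pi_eq0.
exact: TensorRelZ.
Qed.

Lemma tmul0l n : tmul (M := M) (N := N) 0 n = 0.
Proof. by apply: (addrI (tmul 0 n)); rewrite -tmulDl !addr0. Qed.

Lemma tmul0r m : tmul (M := M) (N := N) m 0 = 0.
Proof. by apply: (addrI (tmul m 0)); rewrite -tmulDr !addr0. Qed.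

Lemma tmulBr m n n' : tmul (M := M) (N := N) m (n - n') = tmul m n - tmul m n'.
Proof. by apply/eqP; rewrite eq_sym subr_eq -tmulDr subrK. Qed.

Lemma tmul_suml (I : finType) (f : I -> M) n :
  tmul (M := M) (N := N) (\sum_j f j) n = \sum_j tmul (f j) n.
Proof. by apply: (big_morph (fun m => tmul m n)) => [x y|]; rewrite ?tmulDl ?tmul0l. Qed.

Lemma tmul_sumr (I : finType) m (f : I -> N) :
  tmul (M := M) (N := N) m (\sum_j f j) = \sum_j tmul m (f j).
Proof. by apply: (big_morph (tmul m)) => [x y|]; rewrite ?tmulDr ?tmul0r. Qed.

End TensorTheory.

(** * Functoriality of tensors in the first argument *)

Section FirstArgument.
Variables (R : pzRingType) (M M' : rmodType R) (N : lmodType R) (s : M -> M').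

(** [s] is a plain function, because later it respects only the finitely many linear combinations
    that a given relation involves. *)
Definition free_mapl : {freeg (M * N)%type} -> {freeg (M' * N)%type} :=
  freeg_lift (fun p : M * N => << (s p.1, p.2) >>).

Lemma free_maplU m n : free_mapl << (m, n) >> = << (s m, n) >>.
Proof. exact: freeg_liftU. Qed.
Lemma free_maplB x y : free_mapl (x - y) = free_mapl x - free_mapl y.
Proof. exact: freeg_liftB. Qed.
Lemma free_mapl0 : free_mapl 0 = 0. Proof. exact: freeg_lift0. Qed.

Lemma free_mapl_rel (x : {freeg (M * N)%type}) :
  linear s -> tensor_rel x -> tensor_rel (free_mapl x).
Proof.
move=> ls; have sE m : s m = to_linear ls m by [].
elim=> [|y z _ hy _ hz|m m' n|m n n'|m r n]; rewrite ?free_maplB ?free_maplU.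
- by rewrite free_mapl0; exact: TensorRel0.
- exact: TensorRelB.
- by rewrite !sE linearD; exact: TensorRelDl.
- exact: TensorRelDr.
- by rewrite !sE linearZ; exact: TensorRelZ.
Qed.

End FirstArgument.

Section FirstArgumentComp.
Variables (R : pzRingType) (M : rmodType R) (N N' : lmodType R).

Lemma free_map_mapl (M' : rmodType R) (s : M -> M') (i : {linear N -> N'}) x :
  free_map i (free_mapl s x) = free_mapl s (free_map i x).
Proof.
have free_map0 (L : rmodType R) : free_map (M := L) i 0 = 0.
  by rewrite -(subrr 0) free_mapB subrr.
elim/freeg_subgroup_ind: x => [|y z hy hz|[m n]].
- by rewrite !(free_mapl0, free_map0).
- by rewrite !(free_maplB, free_mapB) hy hz.
- by rewrite !(free_maplU, free_mapU).
Qed.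

Lemma free_mapl_id (x : {freeg (M * N)%type}) :
  exists l : seq M, forall (M' : rmodType R) (s : M -> M') (t : M' -> M),
    {in l, cancel s t} -> free_mapl t (free_mapl s x) = x.
Proof.
elim/freeg_subgroup_ind: x => [|y z [l hl] [l' hl']|[m n]].
- by exists [::] => M' s t _; rewrite !free_mapl0.
- exists (l ++ l') => M' s t st; rewrite !free_maplB (hl _ s t) ?(hl' _ s t) // => m ml; apply: st;
    by rewrite mem_cat ml ?orbT.
- by exists [:: m] => M' s t st; rewrite !free_maplU st // mem_head.
Qed.

(* A derivation of a relation involves finitely many linear combinations in [M],
   so any map respecting these transports it. *)
Lemma tensor_rel_finite (x : {freeg (M * N)%type}) :
  tensor_rel x ->
  exists l : seq (R^c * M * M), forall (M' : rmodType R) (s : M -> M'),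
    (forall a m m', (a, m, m') \in l -> s (a *: m + m') = a *: s m + s m') ->
    tensor_rel (free_mapl s x).
Proof.
elim=> [|y z _ [l hl] _ [l' hl']|m m' n|m n n'|m r n].
- by exists [::] => M' s _; rewrite free_mapl0; exact: TensorRel0.
- exists (l ++ l') => M' s hs; rewrite free_maplB; apply: TensorRelB.
    by apply: hl => a m m' ml; apply: hs; rewrite mem_cat ml.
  by apply: hl' => a m m' ml; apply: hs; rewrite mem_cat ml orbT.
- exists [:: (1, m, m')] => M' s hs; rewrite !free_maplB !free_maplU.
  have -> : s (m + m') = s m + s m'.
    by have := hs 1 m m' (mem_head _ _); rewrite !scale1r.
  exact: TensorRelDl.
- exists [::] => M' s _; rewrite !free_maplB !free_maplU; exact: TensorRelDr.
- exists [:: (1, 0, 0); (r : R^c, m, 0)] => M' s hs; rewrite !free_maplB !free_maplU.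
  have s0 : s 0 = 0.
    have := hs 1 0 0 (mem_head _ _); rewrite !scale1r addr0 => e.
    by apply: (addrI (s 0)); rewrite -e addr0.
  have -> : s ((r : R^c) *: m) = (r : R^c) *: s m.
    by have := hs r m 0; rewrite !inE eqxx orbT s0 !addr0 => ->.
  exact: TensorRelZ.
Qed.

End FirstArgumentComp.

(** * Tensoring with a finite free module *)

Section RowTensor.
Variables (R : pzRingType) (n : nat) (N : lmodType R).

(** The [j]-th coordinate of the isomorphism from [R^n (x) N] to [N^n], on representatives. *)
Definition row_tensor_coef (j : 'I_n) : {freeg ('rV[R^c]_n * N)%type} -> N :=
  freeg_lift (fun p : 'rV[R^c]_n * N => (p.1 0 j : R) *: p.2).

Lemma row_tensor_coefU j x (m : N) :
  row_tensor_coef j << (x, m) >> = (x 0 j : R) *: m.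
Proof. exact: freeg_liftU. Qed.

Lemma row_tensor_coefB j x y :
  row_tensor_coef j (x - y) = row_tensor_coef j x - row_tensor_coef j y.
Proof. exact: freeg_liftB. Qed.

Lemma row_tensor_coef_rel j x : tensor_rel x -> row_tensor_coef j x = 0.
Proof.
elim=> [|y z _ hy _ hz|m m' y|m y y'|m r y];
  rewrite ?row_tensor_coefB ?row_tensor_coefU.
- exact: freeg_lift0.
- by rewrite hy hz subrr.
- by rewrite mxE scalerDl addrAC addrK subrr.
- by rewrite scalerDr addrAC addrK subrr.
- by rewrite mxE scalerA subrr.
Qed.

Lemma row_tensorE (x : {freeg ('rV[R^c]_n * N)%type}) :
  tensor_pi x = \sum_j tmul (delta_mx 0 j : 'rV[R^c]_n) (row_tensor_coef j x).
Proof.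
elim/freeg_subgroup_ind: x => [|y z hy hz|[m y]].
- rewrite (tensor_pi_eq0 0).2; last exact: TensorRel0.
  by rewrite big1 // => j _; rewrite /row_tensor_coef freeg_lift0 tmul0r.
- rewrite tensor_piB hy hz -sumrB; apply: eq_bigr => j _.
  by rewrite row_tensor_coefB tmulBr.
- rewrite -[tensor_pi _]/(tmul m y) [in LHS](row_sum_delta m) tmul_suml.
  by apply: eq_bigr => j _; rewrite row_tensor_coefU tmulZ.
Qed.

End RowTensor.

Section Flat.
Variable R : pzRingType.

(** Tensoring [i] with [R^n] acts as [i] on each of the [n] coordinates, which determine a
    tensor. *)
Lemma row_tensor_inj n (N N' : lmodType R) (i : {linear N -> N'})
    (x : {freeg ('rV[R^c]_n * N)%type}) :
  injective i -> tensor_rel (free_map i x) -> tensor_rel x.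
Proof.
move=> inji ix; apply/tensor_pi_eq0; rewrite row_tensorE big1 // => j _.
have coef_map : row_tensor_coef j (free_map i x) = i (row_tensor_coef j x).
  elim/freeg_subgroup_ind: x {ix} => [|y z hy hz|[m y]].
  - rewrite -(subrr (0 : {freeg ('rV[R^c]_n * N)%type})) free_mapB.
    by rewrite !row_tensor_coefB !subrr linear0.
  - by rewrite free_mapB !row_tensor_coefB hy hz linearB.
  - by rewrite free_mapU !row_tensor_coefU linearZ.
have -> : row_tensor_coef j x = 0; last exact: tmul0r.
by apply: inji; rewrite -coef_map linear0 row_tensor_coef_rel.
Qed.

(** The equational criterion that linear relations in [M] are trivial: [v] collects [j] relations
    among [k] elements, and [e] expresses these through the elements given by [y]. *)
Definition equational (S : pzRingType) (M : lmodType S) : Prop :=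
  forall j k (v : {linear 'rV[S]_j -> 'rV[S]_k}) (x : {linear 'rV[S]_k -> M}),
  (forall t, x (v t) = 0) ->
  exists m (e : {linear 'rV[S]_k -> 'rV[S]_m}) (y : {linear 'rV[S]_m -> M}),
    (forall t, y (e t) = x t) /\ (forall t, e (v t) = 0).

Lemma tensor_pi_surj (M : rmodType R) (N : lmodType R) (a : tensor M N) :
  exists x, a = tensor_pi x.
Proof. by exists (repr a); rewrite /tensor_pi reprK. Qed.

(** [f] sends a member of [s] to the basis vector at its first position and anything else to zero;
    it need not be linear. *)
Lemma lift_to_row (S : pzRingType) (M : lmodType S) (s : seq M) :
  exists (f : M -> 'rV[S]_(size s)) (x : {linear 'rV[S]_(size s) -> M}),
    {in s, cancel f x}.
Proof.
exists (fun m => \row_j (j == index m s :> nat)%:R), (row_map (fun j => nth 0 s j)).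
move=> m ms; rewrite row_mapE; have ims : (index m s < size s)%N by rewrite index_mem.
rewrite (bigD1 (Ordinal ims)) //= mxE eqxx scale1r nth_index // big1 ?addr0 // => j.
by rewrite mxE -val_eqE /= => /negbTE ->; rewrite scale0r.
Qed.

(* A derivation of the vanishing of [z] in [M (x) N'] is transported, by a map
   that is linear on the finitely many elements involved, to a finite free module,
   where [N -> N'] stays injective, and the result is pushed back to [M]. *)
Lemma equational_flat (M : rmodType R) : equational M -> flat M.
Proof.
move=> eqM N N' i inji a b.
have [[za ->] [zb ->]] := (tensor_pi_surj a, tensor_pi_surj b).
rewrite !tensor_map_pi => /tensor_piP; rewrite -free_mapB => rel.
apply/tensor_piP; move: (za - zb) rel => {za zb a b} z rel.
have [l1 hl1] := free_mapl_id z; have [l2 hl2] := tensor_rel_finite rel.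
pose s := l1 ++ flatten [seq [:: p.1.1 *: p.1.2 + p.2; p.1.2; p.2] | p <- l2].
have [f [x fK]] := lift_to_row s.
(* [rho] measures the failure of linearity of [f]. On [l2] its values are killed by [x], so the
   criterion gives an [e] that kills them and makes [e f] linear where needed. *)
pose rho (p : R^c * M * M) := f (p.1.1 *: p.1.2 + p.2) - (p.1.1 *: f p.1.2 + f p.2).
have mem_s p m : p \in l2 -> m \in [:: p.1.1 *: p.1.2 + p.2; p.1.2; p.2] -> m \in s.
  by move=> pl mp; rewrite mem_cat; apply/orP; right; apply/flatten_mapP; exists p.
have xrho p : p \in l2 -> x (rho p) = 0.
  move=> pl; rewrite /rho linearB linearP !fK ?subrr //; apply: (mem_s p _ pl);
    by rewrite !inE eqxx ?orbT.
pose v := row_map (fun j : 'I_(size l2) => rho (tnth (in_tuple l2) j)).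
have [|m [e [y [ye ev]]]] := eqM _ _ v x.
  apply: (eq_row_lin (f := x \o v) (g := \0)) => j.
  by rewrite -[LHS]/(x (v (delta_mx 0 j))) row_map_delta xrho // mem_tnth.
have e_rho p : p \in l2 -> e (rho p) = 0.
  move=> pl; have ip : (index p l2 < size l2)%N by rewrite index_mem.
  have := ev (delta_mx 0 (Ordinal ip)); rewrite row_map_delta.
  by rewrite (tnth_nth p) nth_index.
have rel_row : tensor_rel (free_mapl (e \o f) z).
  apply: (row_tensor_inj inji); rewrite free_map_mapl; apply: hl2 => a p q pl.
  have /eqP := e_rho _ pl; rewrite linearB subr_eq0 => /eqP.
  by rewrite linearP.
rewrite -(hl1 _ (e \o f) y) => [|p pl].
  by apply: free_mapl_rel rel_row => a p q; rewrite linearP.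
by rewrite /= ye fK // mem_cat pl.
Qed.

(** Right exactness of the tensor product in terms of elements: the kernel of [M^k -> M (x) N] is
    spanned by the products of [M] with [ker q]. *)
Lemma tensor0_equational (M : rmodType R) (N : lmodType R) k (q : {linear 'rV[R]_k -> N})
    (x : 'I_k -> M) : surjective_map q ->
  \sum_j tmul (x j) (q (delta_mx 0 j)) = 0 ->
  exists l : seq (M * 'rV[R]_k)%type,
    (forall p, p \in l -> q p.2 = 0) /\
    (forall j, x j = \sum_(p <- l) (p.2 0 j : R^c) *: p.1).
Proof.
move=> surjq; have [c hc] := choice surjq.
(* [c] is a set-theoretic section of [q]; it is linear modulo [ker q], so every
   tensor relation is sent into the span [G] of [M * ker q]. *)
pose psi j : {freeg (M * N)%type} -> M :=
  freeg_lift (fun p : M * N => (c p.2 0 j : R^c) *: p.1).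
pose G (w : 'I_k -> M) := exists l : seq (M * 'rV[R]_k)%type,
    (forall p, p \in l -> q p.2 = 0) /\
    (forall j, w j = \sum_(p <- l) (p.2 0 j : R^c) *: p.1).
have GB w w' : G w -> G w' -> G (fun j => w j - w' j).
  move=> [l [lq lw]] [l' [lq' lw']]; exists (l ++ [seq (- p.1, p.2) | p <- l']); split.
    by move=> p; rewrite mem_cat => /orP[/lq //|/mapP[p' /lq' h ->]].
  move=> j; rewrite big_cat big_map lw lw' -sumrN /=; congr (_ + _).
  by apply: eq_bigr => p _; rewrite scalerN.
have G1 m (t : 'rV[R]_k) : q t = 0 -> G (fun j => (t 0 j : R^c) *: m).
  move=> qt; exists [:: (m, t)]; split=> [p|j]; last by rewrite big_seq1.
  by rewrite inE => /eqP ->.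
have psiB j y z : psi j (y - z) = psi j y - psi j z by exact: freeg_liftB.
have psiU j m n : psi j << (m, n) >> = (c n 0 j : R^c) *: m by exact: freeg_liftU.
have Geq w w' : w =1 w' -> G w -> G w' by move=> /funext ->.
have G0 : G (fun=> 0) by exists [::]; split=> // j; rewrite big_nil.
have relG z : tensor_rel z -> G (psi^~ z).
  elim=> [|y y' _ hy _ hy'|m m' n|m n n'|m r n].
  - by apply: Geq G0 => j; rewrite /psi freeg_lift0.
  - by apply: Geq (GB _ _ hy hy') => j; rewrite psiB.
  - by apply: Geq G0 => j; rewrite !psiB !psiU scalerDr addrAC addrK subrr.
  - apply: Geq (G1 m (c (n + n') - c n - c n') _) => [j|].
      by rewrite !psiB !psiU !mxE !scalerBl.
    by rewrite !linearB !hc addrAC addrK subrr.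
  - apply: Geq (G1 m (r *: c n - c (r *: n)) _) => [j|].
      by rewrite !psiB !psiU !mxE scalerBl scalerA.
    by rewrite linearB linearZ !hc subrr.
pose z : {freeg (M * N)%type} := \sum_j << (x j, q (delta_mx 0 j)) >>.
have zE : tensor_pi z = \sum_j tmul (x j) (q (delta_mx 0 j)).
  by rewrite /z /tensor_pi raddf_sum.
rewrite -zE => /tensor_pi_eq0 /relG Gz.
have psi_z j : psi j z = \sum_i (c (q (delta_mx 0 i)) 0 j : R^c) *: x i.
  rewrite /z; have psi0 : psi j 0 = 0 by exact: freeg_lift0.
  rewrite (big_morph (psi j) (id1 := 0) (op1 := +%R)) //.
    by apply: eq_bigr => i _; rewrite psiU.
  by move=> y y'; have := psiB j y (0 - y'); rewrite (psiB j 0) psi0 !sub0r !opprK.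
(* A basis vector and [c] of its image under [q] differ by an element of [ker q], so [x] agrees with
   [psi z] modulo [G]. *)
have Gx : G (fun j => x j - psi j z).
  have Gsum : G (fun j => \sum_i ((delta_mx 0 i - c (q (delta_mx 0 i))) 0 j : R^c) *: x i).
    have GD w w' : G w -> G w' -> G (fun j => w j + w' j).
      move=> hw hw'; apply: Geq (GB _ _ hw (GB _ _ G0 hw')) => j.
      by rewrite sub0r opprK.
    elim: (index_enum _) => [|i r IHr].
      by apply: Geq G0 => j; rewrite big_nil.
    apply: Geq (GD _ _ (G1 (x i) (delta_mx 0 i - c (q (delta_mx 0 i))) _) IHr) => [j|].
      by rewrite big_cons.
    by rewrite linearB hc subrr.
  apply: Geq Gsum => j; rewrite psi_z.
  under eq_bigr => i _ do rewrite !mxE scalerBl.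
  rewrite sumrB; congr (_ - _); rewrite (bigD1 j) //= eqxx scale1r big1 ?addr0 // => i.
  by rewrite eq_sym => /negbTE ->; rewrite scale0r.
have [l [lq lx]] : G x.
  have := GB _ _ Gx (GB _ _ G0 Gz); apply: Geq => j.
  by rewrite sub0r opprK subrK.
by exists l.
Qed.

Lemma flat_equational (M : rmodType R) : flat M -> equational M.
Proof.
move=> flM j k v x xv.
(* [t] is the transpose of [v]; the tensor [\sum_a x_a (x) e_a] over the image of
   [t] vanishes because it does so in [M (x) R^j]. *)
pose t : {linear 'rV[R]_k -> 'rV[R]_j} :=
  row_map (fun i : 'I_k => \row_l (v (delta_mx 0 l) 0 i : R)).
pose q := quo_proj (ker t).
have hk w : ker t w -> t w = 0 by [].
pose i : {linear quo_lmod (ker t) -> 'rV[R]_j} := quo_factor hk.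
have iq w : i (q w) = t w by exact: quo_factorE.
have inji : injective i.
  move=> a b; have [[a' <-] [b' <-]] := (quo_proj_surj a, quo_proj_surj b).
  rewrite !iq => ab; have tab : t (a' - b') = 0 by rewrite linearB ab subrr.
  by apply/eqP; rewrite -subr_eq0 -linearB; apply/eqP/quo_proj_eq0.
have z0 : \sum_a tmul (x (delta_mx 0 a)) (q (delta_mx 0 a)) = 0.
  apply: (flM _ _ i inji).
  have mapD (y z : tensor M (quo_lmod (ker t))) :
      tensor_map i (y + z) = tensor_map i y + tensor_map i z.
    have [[y' ->] [z' ->]] := (tensor_pi_surj y, tensor_pi_surj z).
    have mapB p r : tensor_map i (tensor_pi (p - r))
        = tensor_map i (tensor_pi p) - tensor_map i (tensor_pi r).
      by rewrite !tensor_map_pi free_mapB tensor_piB.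
    have map0 : tensor_map i (tensor_pi (0 : {freeg (M * quo_lmod (ker t))%type})) = 0.
      by rewrite -[X in tensor_pi X](subrr 0) mapB subrr.
    have piD p r : tensor_pi p + tensor_pi r = tensor_pi (p - (0 - r)) :> tensor M _.
      by rewrite sub0r opprK /tensor_pi raddfD.
    by rewrite piD !mapB map0 sub0r opprK.
  have map0 : tensor_map i (0 : tensor M (quo_lmod (ker t))) = 0.
    by apply: (addrI (tensor_map i 0)); rewrite -mapD !addr0.
  rewrite (big_morph _ mapD map0) map0.
  transitivity (\sum_(a < k) \sum_(l < j)
      tmul ((v (delta_mx 0 l) 0 a) *: x (delta_mx 0 a)) (delta_mx 0 l : 'rV[R]_j)).
    apply: eq_bigr => a _; rewrite tensor_map_tmul iq row_map_delta.
    rewrite [X in tmul _ X]row_sum_delta tmul_sumr; apply: eq_bigr => l _.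
    by rewrite mxE tmulZ.
  (* For fixed [l] the first factors add up to the [l]-th relation, [x] applied to a row of [v]. *)
  rewrite exchange_big big1 // => l _.
  by rewrite -tmul_suml -row_lin_sum xv tmul0l.
have [l [lq lx]] := tensor0_equational (@quo_proj_surj _ _ (ker t)) z0.
(* The elements of [ker t] just found become the columns of [e]; being killed by the transpose of
   [v] means [e v = 0]. *)
pose e : {linear 'rV[R^c]_k -> 'rV[R^c]_(size l)} :=
  row_map (fun a => \row_b ((tnth (in_tuple l) b).2 0 a : R^c)).
pose y : {linear 'rV[R^c]_(size l) -> M} := row_map (fun b => (tnth (in_tuple l) b).1).
exists (size l), e, y; split.
  apply: (eq_row_lin (f := y \o e)) => a.
  rewrite -[LHS]/(y (e (delta_mx 0 a))) row_map_delta [LHS]row_mapE lx [RHS]big_tnth.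
  by apply: eq_bigr => b _; rewrite mxE.
apply: (eq_row_lin (f := e \o v) (g := \0)) => a.
rewrite -[LHS]/(e (v (delta_mx 0 a))) row_mapE; apply/rowP => b.
rewrite summxE mxE.
have tb : t (tnth (in_tuple l) b).2 = 0.
  by apply: (quo_proj_eq0 (ker t) _).1; apply: lq; exact: mem_tnth.
have := congr1 (fun w : 'rV[R]_j => w 0 a) tb; rewrite row_mapE summxE mxE => {2}<-.
by apply: eq_bigr => c _; rewrite !mxE.
Qed.

End Flat.

(** * Weak dimension *)

Section WeakDimension.
Variable R : pzRingType.
Notation S := R^c.

(** The image of [x] lies in a free summand of finite rank, through which [x] factors. *)
Lemma free_mod_flat (T : eqType) : flat (free_mod S T : rmodType R).
Proof.
apply: equational_flat => j k v x xv.
have [m [r [i ri]]] := free_finite_retract x.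
exists m, (r \o x), i; split=> t /=; first exact: ri.
by rewrite xv linear0.
Qed.

(** In a finite-rank summand the relation reads [w v = 0]. Splitting [v] itself gives [v = h0 v]
    with [w h0 = 0], so [1 - h0] kills the image of [v] and leaves [x] unchanged. *)
Lemma free_submod_flat (T : eqType) (U : submod (free_mod S T)) :
  (forall a b c d e, ghost_split 'rV[S]_a 'rV[S]_b 'rV[S]_c 'rV[S]_d 'rV[S]_e) ->
  flat (submod_type U : rmodType R).
Proof.
move=> gs; apply: equational_flat => j k v x xv.
have [m [r [i ri]]] := free_finite_retract (submod_inc U \o x).
pose w : {linear 'rV[S]_k -> 'rV[S]_m} := r \o (submod_inc U \o x).
have wv t : w (v t) = 0 by rewrite /w /= xv !linear0.
have [| | |h0 [h1 [vE wh]]] := gs j k 0 k m v \0 w v.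
- by move=> t; rewrite linear0.
- exact: wv.
- by move=> t vt; exists 0; rewrite vt linear0.
exists k, (addlin idfun (opplin h0)), x; split=> t; last first.
  by rewrite to_linearE /= {1}vE /= addr0 subrr.
rewrite to_linearE linearB /=.
have -> : x (h0 t) = 0; last exact: subr0.
apply: submod_inc_inj; rewrite linear0 -[LHS]/((submod_inc U \o x) (h0 t)) -ri.
by rewrite -[r _]/(w (h0 t)) wh linear0.
Qed.

(** The free module on the elements of [M] and the kernel of its projection to [M] form a flat
    resolution of length 1. *)
Lemma ghost_split_weak_dim :
  (forall a b c d e, ghost_split 'rV[S]_a 'rV[S]_b 'rV[S]_c 'rV[S]_d 'rV[S]_e) ->
  weak_gl_dim_le R 1.
Proof.
move=> gs M; pose p := free_lin (id : M -> M).
pose obj n : rmodType R :=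
  match n with 0%N => free_mod S M | 1%N => submod_type (ker p) | _ => 'rV[S]_0 end.
have flobj n : flat (obj n).
  case: n => [|[|n]]; [exact: free_mod_flat|exact: free_submod_flat|].
  by apply: equational_flat => j k v x xv; exists 0%N, \0, \0; split=> t //; exact/esym/thinmx0.
pose d n : {linear obj n.+1 -> obj n} :=
  match n return {linear obj n.+1 -> obj n} with
  | 0%N => submod_inc (ker p) | _ => \0 end.
have ex0 : exact_at (d 0) p.
  move=> y; split=> [|[x <-]]; last exact: (submod_valP (U := ker p)).
  exact: (submod_incP (U := ker p)).
have exS n : exact_at (d n.+1) (d n).
  case: n => [|n] y; last by split=> _ //; exists 0; exact/esym/thinmx0.
  split=> [dy|[x <-]]; last exact: (linear0 (submod_inc (ker p))).
  by exists 0; apply: submod_inc_inj; rewrite (linear0 (submod_inc (ker p))); exact/esym.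
exists (Resolution flobj (free_cover_surj (M := M)) ex0 exS).
by case=> [|[|k]] // _ x; rewrite thinmx0.
Qed.

Lemma weak_dim_flat_lifting : weak_gl_dim_le R 1 -> flat_lifting S.
Proof.
move=> wd a b d e u k w wku.
pose q := quo_proj (im w).
have exq : exact_at w q by move=> y; exact: quo_proj_eq0.
have [P trivP] := wd (quo_lmod (im w)).
pose d0 := res_d P 0; pose aug := res_aug P.
have ex0 : exact_at d0 aug by exact: res_exact0.
(* Injectivity of [d0] holds by exactness, because [P 2] is trivial. *)
have inj0 y : d0 y = 0 -> y = 0.
  move=> d0y; have [z <-] := exact_lift (@res_exactS _ _ _ P 0) d0y.
  by rewrite [z]trivP ?linear0.
have equP n : equational (P n) by apply: flat_equational; exact: (res_class P n).
have [ep hep] := row_projective q (@res_aug_surj _ _ _ P).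
have [|de hde] := proj_lift (f := d0) (g := ep \o w) (@row_projective _ d).
  by move=> x; apply: (exact_lift ex0); rewrite /= [aug _]hep (exact_comp0 _ exq).
(* Schanuel: [im w] is the kernel of [R^e * P 1 -> P 0], a surjection onto a flat
   module.  The map [(w k, de k)] factors as [b1] through a free module, and
   [c, ga] do the same for the resulting map [phi] to [P 0]. *)
have [|f [b' [p [pb b'u]]]] := equP 1%N _ _ u (de \o k).
  by move=> t; apply: inj0; rewrite hde /= wku linear0.
pose b1 : {linear 'rV[S]_b -> 'rV[S]_(e + f)} :=
  row_map (fun i => row_mx (w (k (delta_mx 0 i))) (b' (delta_mx 0 i))).
have b1E x : b1 x = row_mx (w (k x)) (b' x).
  rewrite row_mapE -[w (k x)]/((w \o k) x) (row_lin_sum (w \o k)) (row_lin_sum b').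
  apply: (big_rec3 (fun s y z => s = row_mx y z)) => [|i s y z _ ->].
    by rewrite row_mx0.
  by rewrite scale_row_mx add_row_mx.
have lL : linear (fun z : 'rV[S]_(e + f) => lsubmx z) by move=> ? ? ?; rewrite linearP.
have lR : linear (fun z : 'rV[S]_(e + f) => rsubmx z) by move=> ? ? ?; rewrite linearP.
pose phi := addlin (ep \o to_linear lL) (opplin (d0 \o p \o to_linear lR)).
have phiE z : phi z = ep (lsubmx z) - d0 (p (rsubmx z)) by [].
have [|g [c [ga [gac cb]]]] := equP 0%N _ _ b1 phi.
  by move=> x; rewrite phiE b1E row_mxKl row_mxKr pb /= hde subrr.
pose T (y : 'rV[S]_e * P 1%N) : P 0%N := ep y.1 - d0 y.2.
have lT : linear T.
  by move=> s y z; rewrite /T !linearP /= addrACA -scalerDr.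
(* [ga] lifts along [T] because [ep] reaches every element of [P 0] modulo the image of [d0]. *)
have [|gh ghE] := proj_lift (f := to_linear lT) (g := ga) (@row_projective _ g).
  move=> z; have [s hs] := @quo_proj_surj _ _ (im w) (aug (ga z)).
  have [|t ht] := exact_lift (y := ep s - ga z) ex0.
    by rewrite linearB [aug (ep s)]hep hs subrr.
  by exists (s, t); rewrite to_linearE /T /= ht opprB addrC subrK.
(* Subtracting [gh (c z)] from the pair defining [phi z] gives an element of the kernel of [T],
   whose first coordinate lies in [im w]. *)
have lth : linear (fun z => lsubmx z - (gh (c z)).1).
  by move=> s y z; rewrite !linearP /= addrACA -scalerDr.
have [|th hth] := proj_lift (f := w) (g := to_linear lth) (@row_projective _ _).
  move=> z; apply: (exact_lift exq).
  rewrite -[to_linear lth z]/(lsubmx z - (gh (c z)).1) -hep linearB.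
  have sub_swap (Z : zmodType) (s t s' t' : Z) : s - t = s' - t' -> s' - s = t' - t.
    by move=> st; rewrite -[s'](subrK t') -st addrAC [s - t]addrC addrK addrC.
  have : T (gh (c z)) = phi z by rewrite -gac -ghE.
  by rewrite phiE /T => /sub_swap ->; rewrite -linearB (exact_comp0 _ ex0).
(* On the image of [b1] the correction by [gh c] vanishes, so [th b1] agrees with [k] under [w], and
   it kills [im u] because [b1] does. *)
have e1 x : th (b1 (u x)) = 0 by rewrite b1E wku b'u row_mx0 linear0.
have e2 x : w (th (b1 x)) = w (k x).
  by rewrite hth to_linearE cb linear0 subr0 b1E row_mxKl.
by exists (th \o b1).
Qed.

End WeakDimension.

Theorem theorem2p1 (R : pzRingType) :
  generating_hypothesis R <->
  (weak_gl_dim_le R 1 /\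
   forall M : rmodType R, finitely_presented M -> FP_injective M).
Proof.
split=> [gh|[wd fpi]].
  have gs a b c d e :
      ghost_split 'rV[R^c]_a 'rV[R^c]_b 'rV[R^c]_c 'rV[R^c]_d 'rV[R^c]_e.
    by apply: generating_ghost_split; [exact: gh|..]; first [exact: row_fg|exact: row_projective].
  split; first exact: ghost_split_weak_dim.
  by move=> M; exact: ghost_split_FP_injective.
move=> X Y f; apply: ghost_derived_null => A B C D E.
(* The terms of perfect complexes are retracts of finite free modules, so the free case suffices. *)
apply: ghost_split_retract; apply: FP_injective_ghost_split fpi _.
exact: weak_dim_flat_lifting.
Qed.
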